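(* Let $(X,f)$ be a dynamical system (with nonempty compact Hausdorff phase space) with $\Phi(\mathcal P(X,f))\neq E$. Then the following statements are equivalent: (i) the category $\mathfrak B_0'(X,f)$ has a left zero $0_L\in\mathrm{Ob}\,\mathfrak B_0'(X,f)$; (ii) the dynamical system $(X,f)$ is indecomposable.
   Context: Here $\mathbb N=\{1,2,\dots\}$. A left zero of a category is an object $0_L$ such that for every object $B$ of the category there is exactly one morphism $0_L\to B$. A dynamical system is a pair $(X,f)$ with $X$ a nonempty compact Hausdorff space and $f:X\to X$ a homeomorphism. A morphism $h:(X,f)\to(Y,g)$ is a continuous map $h:X\to Y$ with $h\circ f=g\circ h$; the category so obtained is $\mathcal K_0$. Topologically conjugate means isomorphic in $\mathcal K_0$. $(X,f)$ is indecomposable if whenever $X=X_1\cup X_2$, $X_1\cap X_2=\emptyset$, with $X_1,X_2$ closed and invariant ($f(X_i)=X_i$), then $X_1=\emptyset$ or $X_2=\emptyset$. A periodic partition of $(X,f)$ of length $m\in\mathbb N$ is a family $\{W_i\}_{i=0}^{m-1}$ of pairwise disjoint open-closed subsets of $X$ with union $X$, such that $f(W_{i-1})=W_i$ for $i=1,\dots,m-1$ and $f(W_{m-1})=W_0$. $\mathcal P(X,f)\subseteq\mathbb N$ is the set of lengths of all periodic partitions of $(X,f)$. An ultranatural number is a family $N=(N_p)_p$ indexed by primes $p$ with $N_p\in\{0,1,2,\dots\}\cup\{\infty\}$; the set $\Sigma$ of these is ordered by $M\le N$ iff $M_p\le N_p$ for all $p$, and $E=(0)_p$ is its least element. For nonempty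 $S\subseteq\mathbb N$, $\Phi(S)\in\Sigma$ is defined by $\Phi(S)_p=\sup\{k\ge 0: p^k \text{ divides some } a\in S\}$. An odometer: given a sequence $\{n_i\}_{i\in\mathbb N}$ of positive integers with $n_i\mid n_{i+1}$ (bounded sequences allowed), $A=\varprojlim \mathbb Z/n_i\mathbb Z$ (inverse limit of discrete cyclic groups along the maps $1\mapsto 1$, with the inverse limit topology) and $g(\vec a)=\vec a+\vec e$, $\vec e=(1,1,\dots)$; $(A,g)$ is the odometer constructed on $\{n_i\}$. $\mathcal A$ is the full subcategory of $\mathcal K_0$ whose objects are the dynamical systems topologically conjugate to odometers; $\mathcal A(X,f)$ is the full subcategory of $\mathcal A$ of objects $(A,g)$ with $\Phi(\mathcal P(A,g))\le\Phi(\mathcal P(X,f))$. A skeleton of a category is a full subcategory containing exactly one representative of each isomorphism class of objects. $\mathcal A_0(X,f)$ is a fixed skeleton of $\mathcal A(X,f)$. The category $\mathfrak B(X,f)$: objects are pairs $(h,(A,g))$ with $(A,g)$ an object of $\mathcal A(X,f)$ and $h:(X,f)\to(A,g)$ a morphism; morphisms from $(h_1,(A_1,g_1))$ to $(h_2,(A_2,g_2))$ are the (triples given by) morphisms $\pi:(A_1,g_1)\to(A_2,g_2)$ with $h_2=\pi\circ h_1$. $\mathfrak B'(X,f)$ is the full subcategory of $\mathfrak B(X,f)$ of objects $(h,(A,g))$ with $(A,g)\in\mathrm{Ob}\,\mathcal A_0(X,f)$, and $\mathfrak B_0'(X,f)$ is a fixed skeleton of $\mathfrak B'(X,f)$. 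*)

(* Defs.v *)
From HB Require Import structures.
From mathcomp Require Import all_boot all_order all_algebra.
From mathcomp Require Import all_classical topology.

Set Implicit Arguments.
Unset Strict Implicit.
Unset Printing Implicit Defensive.

Local Open Scope classical_set_scope.

Record category := Category {
  Ob :> Type;
  Hom : Ob -> Ob -> Type;
  idm : forall A, Hom A A;
  comp : forall A B C, Hom B C -> Hom A B -> Hom A C;
  comp_idl : forall A B (u : Hom A B), comp (idm B) u = u;
  comp_idr : forall A B (u : Hom A B), comp u (idm A) = u;
  comp_assoc : forall A B C D (w : Hom C D) (v : Hom B C) (u : Hom A B),
    comp w (comp v u) = comp (comp w v) u }.

Arguments Hom {c} A B.
Arguments idm {c} A.
Arguments comp {c A B C} v u.

Definition isomorphic (C : category) (A B : C) : Prop :=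
  exists (u : Hom A B) (v : Hom B A), comp v u = idm A /\ comp u v = idm B.

Definition left_zero (C : category) (Z : C) : Prop :=
  forall B : C, exists! u : Hom Z B, True.

Definition full (C : category) (P : C -> Prop) : category :=
  @Category {A : C | P A}
    (fun A B => Hom (sval A) (sval B))
    (fun A => idm (sval A))
    (fun A B D v u => comp v u)
    (fun A B u => comp_idl u)
    (fun A B u => comp_idr u)
    (fun A B D E w v u => comp_assoc w v u).

(* [full S] is a skeleton of [C]. *)
Definition skeleton (C : category) (S : C -> Prop) : Prop :=
  forall A : C, exists! B : C, S B /\ isomorphic A B.

Record dynsys := DynSys {
  space :> topologicalType;
  dmap : space -> space;
  space_nonempty : [set: space] !=set0;
  space_compact : compact [set: space];
  space_hausdorff : hausdorff_space space;
  dmap_continuous : continuous dmap;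
  dmap_homeo : exists2 g : space -> space,
    continuous g & cancel dmap g /\ cancel g dmap }.

Arguments dmap : clear implicits.

Definition is_dmor (X Y : dynsys) (h : X -> Y) : Prop :=
  continuous h /\ h \o dmap X = dmap Y \o h.

Definition dmor (X Y : dynsys) := {h : X -> Y | is_dmor h}.

Lemma sval_inj T (P : T -> Prop) (u v : {x : T | P x}) :
  sval u = sval v -> u = v.
Proof. by case: u v => [x p] [y q] /= e; apply: eq_exist. Qed.

Lemma is_dmor_id (X : dynsys) : is_dmor (@idfun X).
Proof. by split=> // x; exact: cvg_id. Qed.

Lemma is_dmor_comp (X Y Z : dynsys) (v : dmor Y Z) (u : dmor X Y) :
  is_dmor (sval v \o sval u).
Proof.
case: u v => [u [cu eu]] [v [cv ev]] /=; split.
  by move=> x; apply: continuous_comp; [exact: cu | exact: cv].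
by rewrite -compA eu compA ev.
Qed.

Definition dmor_id (X : dynsys) : dmor X X := exist _ idfun (is_dmor_id X).

Definition dmor_comp (X Y Z : dynsys) (v : dmor Y Z) (u : dmor X Y) :
  dmor X Z := exist _ (sval v \o sval u) (is_dmor_comp v u).

Definition K0 : category.
Proof.
refine (@Category dynsys dmor dmor_id dmor_comp _ _ _) => *;
  exact: sval_inj.
Defined.

Definition indecomposable (X : dynsys) : Prop :=
  forall X1 X2 : set X,
    X1 `|` X2 = setT -> X1 `&` X2 = set0 ->
    closed X1 -> closed X2 ->
    dmap X @` X1 = X1 -> dmap X @` X2 = X2 ->
    X1 = set0 \/ X2 = set0.

(* The family is [W 0, ..., W m.-1]; other values of [W] are irrelevant. *)
Definition periodic_partition (X : dynsys) (m : nat) (W : nat -> set X) :=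
  [/\ forall i, (i < m)%N -> clopen (W i),
      trivIset `I_m W,
      \bigcup_(i in `I_m) W i = setT,
      forall i, (0 < i < m)%N -> dmap X @` W i.-1 = W i
    & dmap X @` W m.-1 = W 0].

Arguments periodic_partition : clear implicits.

Definition periods (X : dynsys) : set nat :=
  [set m | (0 < m)%N /\ exists W, periodic_partition X m W].

Inductive enat := Fin of nat | Inf.

Definition enat_le (x y : enat) : Prop :=
  match x, y with
  | _, Inf => True
  | Inf, Fin _ => False
  | Fin m, Fin n => (m <= n)%N
  end.

Definition enat_sup (T : set nat) : enat :=
  if `[< exists m, ubound T m >]
  then Fin (xget 0 (T `&` ubound T)) else Inf.

Lemma enat_supP (T : set nat) (x : enat) :
  enat_le (enat_sup T) x <-> forall k, T k -> enat_le (Fin k) x.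
Proof.
rewrite /enat_sup; case: asboolP => [bT|ubT]; last first.
  case: x => [n|] /=; last by split.
  by split=> // Tn; apply: ubT; exists n.
have [[k0 Tk0]|T0] := pselect (T !=set0); last first.
  have -> : xget 0 (T `&` ubound T) = 0.
    by apply: xgetPN => y [Ty _]; apply: T0; exists y.
  case: x => [n|] /=; last by split.
  by split=> // _ k Tk; case: T0; exists k.
have [m Tm mT] : exists2 m, T m & ubound T m.
  have ex : exists i, `[< T i >] by exists k0; apply/asboolP.
  have [b bb] := bT.
  have ub i : `[< T i >] -> (i <= b)%N by move/asboolP; exact: bb.
  case: (ex_maxnP ex ub) => m /asboolP Tm mmax; exists m => // k Tk.
  by apply: mmax; apply/asboolP.
have [Ts sT] : (T `&` ubound T) (xget 0 (T `&` ubound T)).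
  by apply: (xgetPex 0); exists m.
case: x => [n|] /=; last by split.
by split=> [sn k /sT ks|]; [exact: leq_trans ks sn | exact].
Qed.

Definition ultranat := {p : nat | prime p} -> enat.

Definition ultranat_le (M N : ultranat) : Prop :=
  forall p, enat_le (M p) (N p).

Definition ultranatE : ultranat := fun=> Fin 0.

Definition Phi (S : set nat) : ultranat :=
  fun p => enat_sup [set k | exists2 a, S a & (sval p ^ k %| a)%N].

(* For [0 < n] this is the cyclic group Z/nZ, including for [n = 1]
   (where ['Z_n] would be Z/2Z). *)
Definition cyc (n : nat) := 'I_n.-1.+1.

HB.instance Definition _ n := GRing.Zmodule.on (cyc n).
HB.instance Definition _ n := Finite.on (cyc n).
HB.instance Definition _ n := hasNbhs.Build (cyc n) principal_filter.
HB.instance Definition _ n := Discrete_ofNbhs.Build (cyc n) erefl.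

Definition cyc1 (n : nat) : cyc n := inZp 1.

(* For [m %| n], the homomorphism Z/nZ -> Z/mZ sending 1 to 1. *)
Definition cyc_proj (n m : nat) (x : cyc n) : cyc m := inZp (nat_of_ord x).

Record odo_seq := OdoSeq {
  odo_term :> nat -> nat;
  odo_pos : forall i, (0 < odo_term i)%N;
  odo_dvd : forall i, (odo_term i %| odo_term i.+1)%N }.

Definition invlim (n : odo_seq) : set (prod_topology (fun i => cyc (n i))) :=
  [set a | forall i, cyc_proj (n i) (a i.+1) = a i].

Arguments invlim : clear implicits.

(* The carrier has the topology induced by the product of discrete spaces. *)
Definition odo_space (n : odo_seq) : topologicalType := set_type (invlim n).

Lemma cyc_projD n m (x y : cyc n) : (0 < m)%N -> (0 < n)%N -> (m %| n)%N ->
  cyc_proj m (x + y)%R = (cyc_proj m x + cyc_proj m y)%R.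
Proof.
case: n m x y => [|n] [|m] // x y _ _ mn; apply: val_inj => /=.
by rewrite modn_dvdm // modnDm.
Qed.

Lemma cyc_proj1 n m : (0 < m)%N -> (0 < n)%N -> (m %| n)%N ->
  cyc_proj m (cyc1 n) = cyc1 m.
Proof.
by case: n m => [|n] [|m] // _ _ mn; apply: val_inj => /=; rewrite modn_dvdm.
Qed.

Section Odometer.
Variable n : odo_seq.
Let K (i : nat) : topologicalType := cyc (n i).

Lemma invlimD (a b : prod_topology K) : invlim n a -> invlim n b ->
  invlim n (fun i => (a i + b i)%R).
Proof.
by move=> ha hb i; rewrite cyc_projD ?odo_pos ?odo_dvd// ha hb.
Qed.

Lemma invlim1 : invlim n (fun i => cyc1 (n i)).
Proof. by move=> i; rewrite cyc_proj1 ?odo_pos ?odo_dvd. Qed.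

Lemma invlim0 : invlim n (fun i => 0%R : cyc (n i)).
Proof. by move=> i; apply: val_inj; rewrite /= mod0n. Qed.

Lemma invlimN (a : prod_topology K) : invlim n a ->
  invlim n (fun i => (- a i)%R).
Proof.
move=> ha i; apply: (@GRing.addrI _ (a i)); rewrite GRing.subrr.
rewrite -{1}(ha i) -cyc_projD ?odo_pos ?odo_dvd// GRing.subrr.
by apply: val_inj; rewrite /= mod0n.
Qed.

Definition odo_add (a b : odo_space n) : odo_space n :=
  SigSub (mem_set (invlimD (set_mem (valP a)) (set_mem (valP b)))).

Definition odo_opp (a : odo_space n) : odo_space n :=
  SigSub (mem_set (invlimN (set_mem (valP a)))).

Definition odo_one : odo_space n := SigSub (mem_set invlim1).

Definition odo_map (a : odo_space n) : odo_space n := odo_add a odo_one.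

Definition odo_inv (a : odo_space n) : odo_space n :=
  odo_add a (odo_opp odo_one).

Lemma odo_mapK : cancel odo_map odo_inv.
Proof.
move=> a; apply: val_inj; apply: functional_extensionality_dep => i /=.
by rewrite GRing.addrK.
Qed.

Lemma odo_invK : cancel odo_inv odo_map.
Proof.
move=> a; apply: val_inj; apply: functional_extensionality_dep => i /=.
by rewrite GRing.subrK.
Qed.

Lemma odo_add_continuous (b : odo_space n) :
  continuous (fun a => odo_add a b).
Proof.
apply: continuous_comp_initial => a; apply/cvg_sup.
  exact/fmap_filter/(nbhs_filter (a : odo_space n)).
move=> i.
move: a; apply/(@continuousP _ (initial_topology (@^~ i))) => _ [B oB <-].
pose p (a : odo_space n) : K i := proj i (val a : prod_topology K).
have cp : continuous p.
  move=> a; apply: continuous_comp; first exact: initial_continuous.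
  exact: (@proj_continuous nat K).
rewrite (_ : _ @^-1` _ = p @^-1` [set x : K i | B (x + val b i)%R]) //.
by apply: open_comp => [? _|]; [exact: cp | exact: discrete_open].
Qed.

Lemma invlim_closed : closed (invlim n).
Proof.
move=> a cla i.
have oU : nbhs (a : prod_topology K)
    ((proj i @^-1` [set a i]) `&` (proj i.+1 @^-1` [set a i.+1])).
  by apply: filterI; apply: (@proj_continuous nat K); exact: discrete_set1.
by have [b [hb [/= <- <-]]] := cla _ oU; exact: hb.
Qed.

Lemma invlim_compact : compact (invlim n).
Proof.
apply: (@subclosed_compact _ _ [set f : prod_topology K | forall i, setT (f i)]).
- exact: invlim_closed.
- apply: (@tychonoff nat K (fun=> setT)) => i.
  exact/finite_compact/finite_finset.
- by [].
Qed.

Lemma odo_nonempty : [set: odo_space n] !=set0.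
Proof. by exists odo_one. Qed.

Lemma odo_val_continuous :
  continuous (val : odo_space n -> prod_topology K).
Proof. exact: initial_continuous. Qed.

Lemma odo_compact : compact [set: odo_space n].
Proof.
move=> F PF _.
have [|a [ha cla]] := @invlim_compact (val @ F) _.
  by apply: (@filterE _ F) => a; exact: set_mem (svalP a).
exists (SigSub (mem_set ha)); split=> // A B FA.
move=> [_ [[C oC <-] Ca CB]].
have FA' : (val @ F) (val @` A).
  by apply: (@filterS _ F) FA => x Ax; exists x.
have [_ [[x Ax <-] Cx]] := cla _ _ FA' (open_nbhs_nbhs (conj oC Ca)).
by exists x; split=> //; exact: CB.
Qed.

Lemma odo_hausdorff : hausdorff_space (odo_space n).
Proof.
move=> a b cab; apply: val_inj.
apply: (@hausdorff_product nat K (fun i => discrete_hausdorff)).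
move=> A B Aa Bb.
by have [x [Ax Bx]] := cab _ _ (odo_val_continuous Aa) (odo_val_continuous Bb);
  exists (val x).
Qed.

Definition odometer : dynsys.
Proof.
refine (@DynSys (odo_space n) odo_map odo_nonempty odo_compact odo_hausdorff
  (@odo_add_continuous odo_one) _).
by exists odo_inv; [exact: odo_add_continuous|split;
  [exact: odo_mapK|exact: odo_invK]].
Defined.

End Odometer.

Definition catA : category :=
  @full K0 (fun A => exists n : odo_seq, isomorphic (A : K0) (odometer n : K0)).

Definition catAX (X : K0) : category :=
  @full catA (fun A => ultranat_le (Phi (periods (sval A))) (Phi (periods X))).

Definition sysAX (X : K0) (A : catAX X) : K0 := sval (sval A).

Section CategoryB.
Variable X : K0.

Definition ObB := {A : catAX X & Hom X (sysAX A)}.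

Definition HomB (b1 b2 : ObB) :=
  {u : Hom (projT1 b1) (projT1 b2) |
     projT2 b2 = comp (u : Hom (sysAX (projT1 b1)) (sysAX (projT1 b2)))
                      (projT2 b1)}.

Lemma idmB_proof (b : ObB) :
  projT2 b = comp (idm (sysAX (projT1 b))) (projT2 b).
Proof. by rewrite comp_idl. Qed.

Definition idmB (b : ObB) : HomB b b :=
  exist _ (idm (projT1 b)) (idmB_proof b).

Lemma compB_proof (b1 b2 b3 : ObB) (v : HomB b2 b3) (u : HomB b1 b2) :
  projT2 b3 = comp (comp (sval v) (sval u)
    : Hom (sysAX (projT1 b1)) (sysAX (projT1 b3))) (projT2 b1).
Proof.
case: u v => [u eu] [v ev] /=; rewrite ev eu.
exact: (@comp_assoc K0).
Qed.

Definition compB (b1 b2 b3 : ObB) (v : HomB b2 b3) (u : HomB b1 b2) :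
  HomB b1 b3 := exist _ (comp (sval v) (sval u)) (compB_proof v u).

Definition catB : category.
Proof.
refine (@Category ObB HomB idmB compB _ _ _) => *; apply: sval_inj.
- exact: (@comp_idl K0).
- exact: (@comp_idr K0).
- exact: (@comp_assoc K0).
Defined.

(* [S0] is the class of objects of the chosen skeleton of [catAX X]. *)
Definition catB' (S0 : catAX X -> Prop) : category :=
  @full catB (fun b => S0 (projT1 b)).

End CategoryB.

(* Main.v *)
From mathcomp Require Import all_boot all_algebra.
From mathcomp Require Import all_classical topology.
Require Import Defs.

(** Passing to an isomorphism-dense full subcategory changes nothing about the
    existence of a left zero ([left_zero_full]), so the two skeletons disappear
    and the question is whether the category [catB X] of all maps from [X] to
    odometers has a left zero.

    A periodic partition of length [m] is the same thing as a clock modulo [m]: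
    a locally constant [c : X -> nat] that advances by one modulo [m] along the
    dynamics ([periodsP]). A morphism from [X] to the odometer on [n] is a
    compatible family of clocks modulo the [n i] ([odometer_dmor_clocks]).
    Orbits in an odometer are dense, so two morphisms out of an odometer that
    agree at one point are equal ([odometer_dmor_unique]); hence [catB X] has at
    most one morphism between any two objects ([catB_hom_unique]).

    If [X] has a left zero, suppose that it splits into two nonempty clopen
    invariant pieces. Since [Phi (periods X)] is not trivial, some prime [p] is
    the modulus of a clock [c], and adding one to [c] on one of the two pieces
    gives another clock. Both give maps from [X] to Z/pZ that factor through
    the left zero [h : X -> A] by maps [u], [v] out of [A]. The two clocks agree
    on the other piece, so [u] and [v] agree at a point of [A], hence
    everywhere, which contradicts that the clocks differ.

    If [X] is indecomposable, two clocks with the same modulus that agree at one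
    point agree everywhere ([clock_unique]). So the periods of [X] are closed
    under lcm ([periods_lcm]), and the clocks that vanish at a base point form a
    map from [X] to the odometer on a sequence of periods cofinal for
    divisibility. Every map from [X] to an odometer factors through that map,
    because each of its coordinates is, up to a shift, a based clock. *)

Set Implicit Arguments.
Unset Strict Implicit.
Unset Printing Implicit Defensive.

Local Open Scope classical_set_scope.

(** * Left zeros and full subcategories *)

Lemma isomorphic_refl (C : category) (A : C) : isomorphic A A.
Proof. by exists (idm A), (idm A); rewrite !comp_idl. Qed.

Definition iso_dense (C : category) (P : C -> Prop) : Prop :=
  forall A : C, exists2 B : C, P B & isomorphic A B.

Lemma skeleton_iso_dense (C : category) (S : C -> Prop) :
  skeleton S -> iso_dense S.
Proof. by move=> skS A; have [B [[SB isoAB] _]] := skS A; exists B. Qed.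

Lemma left_zero_iso (C : category) (Z Z' : C) :
  isomorphic Z Z' -> left_zero Z -> left_zero Z'.
Proof.
move=> [u [v [_ uv]]] lzZ B; have [w [_ wuniq]] := lzZ B.
exists (comp w v); split=> // w' _.
by rewrite (wuniq (comp w' u) I) -comp_assoc uv comp_idr.
Qed.

(** Morphisms in a full subcategory are those of the ambient category, and
    being a left zero is transported along isomorphisms both in the source and
    in the targets against which it is tested. *)
Lemma left_zero_full (C : category) (P : C -> Prop) :
  iso_dense P ->
  (exists Z : full P, left_zero Z) <-> (exists Z : C, left_zero Z).
Proof.
move=> denseP; split=> [[[Z PZ] lzZ]|[Z lzZ]].
  exists Z => A; have [B PB [u [v [vu _]]]] := denseP A.
  have [w [_ wuniq]] := lzZ (exist _ B PB).
  exists (comp v (w : Hom Z B)); split=> // w' _.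
  by rewrite (wuniq (comp u w' : Hom Z B) I) comp_assoc vu comp_idl.
have [Z' PZ' isoZ] := denseP Z.
by exists (exist _ Z' PZ') => -[B PB]; exact: (left_zero_iso isoZ lzZ B).
Qed.

Definition catB_hom (X : K0) (b1 b2 : catB X) (u : Hom (projT1 b1) (projT1 b2))
    (e : projT2 b2 = comp (u : Hom (sysAX (projT1 b1)) (sysAX (projT1 b2)))
                          (projT2 b1)) : Hom b1 b2 :=
  exist _ u e.

(** An isomorphism [A -> B] in [catAX X] carries an object [(h, A)] of
    [catB X] to an isomorphic object over [B]. *)
Lemma catB'_iso_dense (X : K0) (S0 : catAX X -> Prop) :
  iso_dense S0 -> iso_dense (fun b : catB X => S0 (projT1 b)).
Proof.
move=> dense0 [A h]; have [B SB [u [v [vu uv]]]] := dense0 A.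
pose h' : Hom X (sysAX B) := comp (u : Hom (sysAX A) (sysAX B)) h.
have hv : h = comp (v : Hom (sysAX B) (sysAX A)) h'.
  rewrite /h' (@comp_assoc K0).
  rewrite (_ : comp _ _ = idm (sysAX A)); first by rewrite comp_idl.
  exact: vu.
exists (existT _ B h') => //.
exists (@catB_hom X (existT _ A h) (existT _ B h') u erefl).
exists (@catB_hom X (existT _ B h') (existT _ A h) v hv).
by split; apply: sval_inj.
Qed.

(** * Locally constant functions and clocks *)

(** Continuity for the discrete topology on [T], for an arbitrary type [T]. *)
Definition locconst (X : topologicalType) (T : Type) (c : X -> T) : Prop :=
  forall B : set T, open (c @^-1` B).

Lemma locconst_comp (X : topologicalType) (T U : Type) (c : X -> T)
    (g : T -> U) : locconst c -> locconst (g \o c).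
Proof. by move=> lc B; exact: (lc (g @^-1` B)). Qed.

Lemma locconst_pair (X : topologicalType) (T U : Type) (c : X -> T)
    (d : X -> U) : locconst c -> locconst d -> locconst (fun x => (c x, d x)).
Proof.
move=> lc ld B.
rewrite (_ : _ @^-1` B =
  \bigcup_(t in @setT T) (c @^-1` [set t] `&` d @^-1` [set u | B (t, u)])).
  by apply: bigcup_open => t _; apply: openI; [exact: lc | exact: ld].
by apply/seteqP; split=> x /=; [exists (c x) | case=> t _ [/= <-]].
Qed.

Lemma locconst_clopen (X : topologicalType) (T : Type) (c : X -> T)
    (B : set T) : locconst c -> clopen (c @^-1` B).
Proof. by move=> lc; split; [exact: lc | rewrite -openC; exact: (lc (~` B))]. Qed.

Lemma locconst_bool (X : topologicalType) (D : set X) :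
  clopen D -> locconst (fun x => `[< D x >]).
Proof.
move=> [oD cD] B.
have [Bt|Bt] := pselect (B true); have [Bf|Bf] := pselect (B false).
- rewrite (_ : _ @^-1` B = setT); first exact: openT.
  by apply/seteqP; split=> x //= _; case: `[< _ >].
- rewrite (_ : _ @^-1` B = D) //.
  by apply/seteqP; split=> x /=; case: asboolP.
- rewrite (_ : _ @^-1` B = ~` D); first by rewrite openC.
  by apply/seteqP; split=> x /=; case: asboolP.
- rewrite (_ : _ @^-1` B = set0); first exact: open0.
  by apply/seteqP; split=> x //=; case: asboolP.
Qed.

(** Continuous maps to Z/mZ that intertwine the dynamics with adding one. The
    values are natural numbers read modulo [m], so that reducing the modulus
    leaves the function unchanged and no type depends on [m]. *)
Definition clock (X : dynsys) (m : nat) (c : X -> nat) : Prop :=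
  locconst c /\ forall x, c (dmap X x) = (c x).+1 %[mod m].

Lemma clock_dvd (X : dynsys) (d m : nat) (c : X -> nat) :
  (d %| m)%N -> clock m c -> clock d c.
Proof.
move=> dm [lc cf]; split=> // x.
by rewrite -(modn_dvdm _ dm) cf modn_dvdm.
Qed.

Lemma clock_shift (X : dynsys) (m k : nat) (c : X -> nat) :
  clock m c -> clock m (fun x => c x + k)%N.
Proof.
move=> [lc cf]; split=> [|x]; first exact: (locconst_comp (addn^~ k) lc).
by rewrite -modnDml cf modnDml addSn.
Qed.

Lemma clock_comp (X Y : dynsys) (m : nat) (h : X -> Y) (c : Y -> nat) :
  is_dmor h -> clock m c -> clock m (c \o h).
Proof.
move=> [ch hf] [lc cf]; split=> [B|x /=].
  rewrite comp_preimage; apply: open_comp => [x _|]; [exact: ch | exact: lc].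
by rewrite -cf; congr (c _ %% m); exact: (congr1 (@^~ x) hf).
Qed.

Lemma dmor_iter (X Y : dynsys) (h : X -> Y) k x : is_dmor h ->
  h (iter k (dmap X) x) = iter k (dmap Y) (h x).
Proof.
move=> [_ hf]; elim: k => //= k <-; exact: (congr1 (@^~ _) hf).
Qed.

Lemma dmap_surj (X : dynsys) (y : X) : exists x, dmap X x = y.
Proof. by have [g _ [_ gK]] := dmap_homeo X; exists (g y). Qed.

Lemma dmap_inj (X : dynsys) : injective (dmap X).
Proof. by have [g _ [fK _]] := dmap_homeo X; exact: can_inj fK. Qed.

Lemma clock_partition (X : dynsys) (m : nat) (c : X -> nat) :
  (0 < m)%N -> clock m c ->
  periodic_partition X m (fun i => [set x | c x = i %[mod m]]).
Proof.
move=> m0 [lc cf]; split.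
- move=> i _; exact: (locconst_clopen [set k | k = i %[mod m]] lc).
- move=> i j /= im jm [x [/= -> ]].
  by rewrite !modn_small.
- apply/seteqP; split=> x //= _; exists (c x %% m)%N => /=.
    exact: ltn_pmod.
  by rewrite modn_mod.
- move=> [|i] //= im; apply/seteqP; split=> [_ [x /= cx <-]|y /= cy].
    by rewrite cf -addn1 -modnDml cx modnDml addn1.
  have [x xy] := dmap_surj y; exists x => //=.
  apply/eqP; rewrite -(eqn_modDr 1) !addn1 -cf xy; exact/eqP.
- have m1 : (m.-1 + 1 = m)%N by rewrite addn1 prednK.
  apply/seteqP; split=> [_ [x /= cx <-]|y /= cy].
    by rewrite cf -addn1 -modnDml cx modnDml m1 modnn mod0n.
  have [x xy] := dmap_surj y; exists x => //=.
  by apply/eqP; rewrite -(eqn_modDr 1) m1 addn1 -cf xy cy modnn mod0n.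
Qed.

Lemma partition_clock (X : dynsys) (m : nat) (W : nat -> set X) :
  (0 < m)%N -> periodic_partition X m W -> exists c : X -> nat, clock m c.
Proof.
move=> m0 [Wcl Wtriv Wcov Wsucc Wlast].
have cW x : exists i, (i < m)%N /\ W i x.
  have : (\bigcup_(i in `I_m) W i) x by rewrite Wcov.
  by case=> i im Wx; exists i.
have [c cP] := choice cW.
have cE i x : (i < m)%N -> W i x -> c x = i.
  by move=> im Wx; have [cm Wc] := cP x; apply: Wtriv => //; exists x.
exists c; split=> [B|x].
  rewrite (_ : c @^-1` B = \bigcup_(i in B `&` `I_m) W i).
    by apply: bigcup_open => i [_ im]; case: (Wcl i im).
  apply/seteqP; split=> [x Bx|x [i [Bi im] Wx]] /=.
    by have [cm Wc] := cP x; exists (c x).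
  by rewrite (cE i).
have [cm Wc] := cP x.
have [e|ne] := eqVneq (c x).+1 m.
  rewrite e modnn; rewrite (cE 0) ?mod0n // -Wlast.
  by exists x => //; rewrite -e.
have lt : ((c x).+1 < m)%N by rewrite ltn_neqAle ne.
by rewrite (cE (c x).+1) // -Wsucc ?lt //; exists x.
Qed.

(** The correspondence sends a clock [c] to the classes of [c] modulo [m], and
    a partition [W] to the index of the block of a point. *)
Lemma periodsP (X : dynsys) (m : nat) :
  periods X m <-> (0 < m)%N /\ exists c : X -> nat, clock m c.
Proof.
split=> [[m0 [W pW]]|[m0 [c cc]]]; split=> //.
  exact: partition_clock pW.
by eexists; exact: clock_partition cc.
Qed.

Lemma periods_dmor (X Y : dynsys) (h : X -> Y) :
  is_dmor h -> periods Y `<=` periods X.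
Proof.
move=> hm m /periodsP[m0 [c cc]]; apply/periodsP; split=> //.
by exists (c \o h); exact: clock_comp.
Qed.

Lemma Phi_le (S T : set nat) : S `<=` T -> ultranat_le (Phi S) (Phi T).
Proof.
move=> ST p; apply/enat_supP => k [a Sa pa].
have enat_le_refl (x : enat) : enat_le x x by case: x => /=.
by apply: (iffLR (enat_supP _ _) (enat_le_refl _)); exists a => //; exact: ST.
Qed.

Lemma Phi_neqE (S : set nat) : Phi S <> ultranatE ->
  exists2 p, prime p & exists2 a, S a & (p %| a)%N.
Proof.
move=> SE; apply: contrapT => noprime; apply: SE.
apply: functional_extensionality_dep => p; rewrite /ultranatE.
suff : enat_le (Phi S p) (Fin 0).
  by case: (Phi S p) => //= k; rewrite leqn0 => /eqP ->.
apply/enat_supP => -[|k] //= [a Sa pa]; case: noprime.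
exists (sval p); first exact: (proj2_sig p).
by exists a => //; apply: dvdn_trans pa; rewrite expnS dvdn_mulr.
Qed.

(** * Clocks on indecomposable systems *)

Section Indecomposable.
Variable X : dynsys.
Hypothesis indX : indecomposable X.

Lemma indecomposable_invariant (D : set X) (x0 : X) :
  clopen D -> (forall x, D (dmap X x) <-> D x) -> D x0 -> forall x, D x.
Proof.
move=> [oD cD] invD Dx0 x; apply: contrapT => Dx.
have inv (Y : set X) : (forall x, Y (dmap X x) <-> Y x) -> dmap X @` Y = Y.
  move=> invY; apply/seteqP; split=> [_ [y /invY Yy <-]|y] //.
  by have [z <-] := dmap_surj y; move/invY => Yz; exists z.
have := indX (setUv D) (setICr D) cD _ (inv _ invD) _.
case=> [||D0|D0].
- by rewrite closedC.
- by apply: inv => y; split=> nD /invD.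
- by have : D x0 := Dx0; rewrite D0.
- by have : (~` D) x := Dx; rewrite D0.
Qed.

(** The set where two clocks agree modulo [m] is clopen and invariant. *)
Lemma clock_unique (m : nat) (c d : X -> nat) (x0 : X) :
  clock m c -> clock m d -> c x0 = d x0 %[mod m] ->
  forall x, c x = d x %[mod m].
Proof.
move=> [lc cf] [ld df].
apply: indecomposable_invariant => [|x].
  exact: (locconst_clopen [set t | t.1 = t.2 %[mod m]] (locconst_pair lc ld)).
rewrite cf df -[(c x).+1]addn1 -[(d x).+1]addn1.
by split=> /eqP e; apply/eqP; move: e; rewrite eqn_modDr.
Qed.

Lemma clock_based (m : nat) (x0 : X) :
  periods X m -> exists2 c, clock m c & c x0 = 0 %[mod m].
Proof.
move=> /periodsP[m0 [c cc]].
exists (fun x => c x + (m - c x0 %% m))%N; first exact: clock_shift.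
by rewrite -modnDml subnKC ?modnn ?mod0n // ltnW // ltn_pmod.
Qed.

(** Take clocks [c] modulo [m] and [d] modulo [n] that both vanish at [x0]. The
    set of points where the congruences [k = c x] modulo [m] and [k = d x]
    modulo [n] have a common solution [k] is clopen, invariant and contains
    [x0], so it is the whole space; a solution chosen as a function of
    [(c x, d x)] is a clock modulo the lcm. *)
Lemma periods_lcm (m n : nat) :
  periods X m -> periods X n -> periods X (lcmn m n).
Proof.
move=> pm pn; have [x0 _] := @space_nonempty X.
have [c cc c0] := clock_based x0 pm; have [d cd d0] := clock_based x0 pn.
apply/periodsP; split.
  by case/periodsP: pm => m0 _; case/periodsP: pn => n0 _; rewrite lcmn_gt0 m0.
have [[lc cf] [ld df]] := (cc, cd).
pose R t : set nat := [set k | k = t.1 %[mod m] /\ k = t.2 %[mod n]].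
have Rcd : forall x, exists k, R (c x, d x) k.
  apply: (@indecomposable_invariant _ x0) => [||]; last by exists 0.
    exact: (locconst_clopen [set t | exists k, R t k] (locconst_pair lc ld)).
  move=> x; split=> -[k /= []]; rewrite ?cf ?df => kc kd; last first.
    exists k.+1; split=> /=; rewrite ?cf ?df -addn1 -modnDml.
      by rewrite kc modnDml addn1.
    by rewrite kd modnDml addn1.
  (* Adding [lcmn m n - 1] subtracts one modulo both [m] and [n]. *)
  exists (k + (lcmn m n).-1)%N.
  have l1 : (lcmn m n).-1.+1 = lcmn m n.
    rewrite prednK // lcmn_gt0.
    by case/periodsP: pm => -> _; case/periodsP: pn => -> _.
  have sub y p : (p %| lcmn m n)%N -> k = y.+1 %[mod p] ->
      (k + (lcmn m n).-1)%N = y %[mod p].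
    move=> pl e; rewrite -modnDml e modnDml addSnnS l1.
    by rewrite -modnDmr (eqP pl) addn0.
  by split; apply: sub => //; [exact: dvdn_lcml | exact: dvdn_lcmr].
exists (fun x => xget 0 (R (c x, d x))); split.
  exact: (locconst_comp (fun t => xget 0 (R t)) (locconst_pair lc ld)).
move=> x.
have [] := xgetPex 0 (Rcd x); set k := xget 0 _ => /= kc kd.
have [] := xgetPex 0 (Rcd (dmap X x)); set l := xget 0 _ => /= lc' ld'.
have cong p (a : nat) : k = a %[mod p] -> l = a.+1 %[mod p] ->
    l = k.+1 %[mod p].
  by move=> ka la; rewrite -addn1 -modnDml ka modnDml addn1.
have [em en] : l = k.+1 %[mod m] /\ l = k.+1 %[mod n].
  by split; [apply: cong kc _; rewrite lc' cf | apply: cong kd _; rewrite ld' df].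
apply/eqP; have [kl|lk] := leqP k.+1 l.
  by rewrite eqn_mod_dvd // dvdn_lcm -!eqn_mod_dvd // em en !eqxx.
rewrite eq_sym eqn_mod_dvd ?(ltnW lk) // dvdn_lcm.
by rewrite -!eqn_mod_dvd ?(ltnW lk) // em en !eqxx.
Qed.

End Indecomposable.

(** * Odometers *)

Lemma cyc_valE n k : (0 < n)%N -> nat_of_ord (inZp k : cyc n) = (k %% n)%N.
Proof. by case: n. Qed.

Lemma cyc_val_add1 n (x : cyc n) : (0 < n)%N ->
  nat_of_ord (x + cyc1 n)%R = (nat_of_ord x).+1 %[mod n].
Proof. by case: n x => // n x _; rewrite /= modn_mod modnDmr addn1. Qed.

Lemma cyc_proj_inZp n m k l : (0 < m)%N -> (0 < n)%N -> (m %| n)%N ->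
  k = l %[mod m] -> cyc_proj m (inZp k : cyc n) = (inZp l : cyc m).
Proof.
case: n m => [|n] [|m] // _ _ mn kl; apply: val_inj => /=.
by rewrite modn_dvdm.
Qed.

Section OdometerMaps.
Variable n : odo_seq.

Definition coord (i : nat) (a : odometer n) : nat :=
  nat_of_ord (val (a : odo_space n) i).

Lemma coord_ltn i a : (coord i a < n i)%N.
Proof. by rewrite -[X in (_ < X)%N](prednK (odo_pos n i)) ltn_ord. Qed.

Lemma odometer_eq (a b : odometer n) :
  (forall i, coord i a = coord i b) -> a = b.
Proof.
move=> e; apply: (val_inj (u1 := (a : odo_space n))).
by apply: functional_extensionality_dep => i; apply: val_inj; exact: e.
Qed.

Lemma coordS i a : coord i a = coord i.+1 a %[mod n i].
Proof.
have := congr1 (@nat_of_ord _) (set_mem (valP (a : odo_space n)) i).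
by rewrite cyc_valE ?odo_pos // /coord => <-; rewrite modn_mod.
Qed.

Lemma odo_dvd_le i j : (i <= j)%N -> (n i %| n j)%N.
Proof.
move=> /subnK <-; elim: (j - i)%N => // k IH.
exact: dvdn_trans IH (odo_dvd n _).
Qed.

Lemma coord_le i j a : (i <= j)%N -> coord i a = coord j a %[mod n i].
Proof.
move=> /subnK <-; elim: (j - i)%N => // k ->.
rewrite -(modn_dvdm _ (odo_dvd_le (leq_addl k i))) coordS.
by rewrite modn_dvdm // odo_dvd_le // leq_addl.
Qed.

Lemma coord_locconst i : locconst (coord i).
Proof.
move=> B; rewrite (_ : coord i @^-1` B = (val : odo_space n -> _) @^-1`
  (proj i @^-1` [set x : cyc (n i) | B (nat_of_ord x)])) //.
apply: open_comp => [a _|]; first exact: odo_val_continuous.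
apply: open_comp => [a _|]; last exact: discrete_open.
exact: (@proj_continuous nat (fun i => cyc (n i))).
Qed.

Lemma coord_clock i : @clock (odometer n) (n i) (coord i).
Proof.
split=> [|a]; first exact: coord_locconst.
exact: cyc_val_add1 (odo_pos n i).
Qed.

Lemma cvg_odometer (F : set_system (odometer n)) (b : odometer n) :
  Filter F -> (forall i, F [set a | coord i a = coord i b]) -> F --> b.
Proof.
move=> FF Fb A [_ [[C oC <-] Cb CA]].
apply: (@filterS _ F _ _ _ CA).
suff : (val : odo_space n -> _) @ F -->
    (val (b : odo_space n) : prod_topology (fun i => cyc (n i))).
  by apply; exact: open_nbhs_nbhs.
apply/cvg_sup => i D [_ [[B oB <-] Bb BD]].
apply: (@filterS _ F FF _ (fun a : odo_space n => D (val a)) _ (Fb i)).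
move=> a ab; apply: BD => /=.
by rewrite (_ : val (a : odo_space n) i = val (b : odo_space n) i) //;
  exact: val_inj.
Qed.

Lemma continuous_odometer (X : topologicalType) (h : X -> odometer n) :
  (forall i, locconst (coord i \o h)) -> continuous h.
Proof.
move=> lh x; apply: cvg_odometer => i.
apply: open_nbhs_nbhs; split=> //.
exact: (lh i [set k | k = coord i (h x)]).
Qed.

Lemma coord_iter i k a :
  coord i (iter k (dmap (odometer n)) a) = coord i a + k %[mod n i].
Proof.
elim: k => [|k IH]; first by rewrite addn0.
by rewrite iterS (coord_clock i).2 -addn1 -modnDml IH modnDml addn1 addnS.
Qed.

(** Orbits are dense: the iterate that matches [b] in coordinate [j] matches it
    in all earlier coordinates too. *)
Lemma odometer_orbit_cvg (a b : odometer n) :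
  exists k : nat -> nat,
    (fun j => iter (k j) (dmap (odometer n)) a) @ \oo --> b.
Proof.
(* [n j] is added to avoid truncation in [coord j b - coord j a]. *)
exists (fun j => coord j b + (n j - coord j a))%N.
apply: cvg_odometer => i; exists i => //= j /= ij.
rewrite -(modn_small (coord_ltn i _)) -[RHS](modn_small (coord_ltn i _)).
rewrite coord_iter -modnDml (coord_le _ ij) modnDml.
rewrite addnCA subnKC ?(ltnW (coord_ltn _ _)) //.
rewrite [RHS](coord_le _ ij) -modnDmr.
by move: (odo_dvd_le ij) => /eqP ->; rewrite addn0.
Qed.

(** The two morphisms agree along the orbit of [a], hence at its limit points,
    as [Y] is Hausdorff. *)
Lemma odometer_dmor_unique (Y : dynsys) (u v : odometer n -> Y) a :
  is_dmor u -> is_dmor v -> u a = v a -> u = v.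
Proof.
move=> mu mv uva; apply/funext => b.
have [k kb] := odometer_orbit_cvg a b.
have cu : (fun j => iter (k j) (dmap Y) (u a)) @ \oo --> u b.
  under eq_fun => j do rewrite -dmor_iter //.
  exact: (cvg_comp _ u kb (mu.1 b)).
have cv : (fun j => iter (k j) (dmap Y) (u a)) @ \oo --> v b.
  rewrite uva; under eq_fun => j do rewrite -dmor_iter //.
  exact: (cvg_comp _ v kb (mv.1 b)).
exact: (cvg_unique (@space_hausdorff Y) cu cv).
Qed.

(** The universal property of the inverse limit, phrased with clocks. *)
Lemma odometer_dmor_clocks (X : dynsys) (c : nat -> X -> nat) :
  (forall i, clock (n i) (c i)) ->
  (forall i x, c i x = c i.+1 x %[mod n i]) ->
  exists2 h : X -> odometer n, is_dmor h &
    forall i x, coord i (h x) = c i x %[mod n i].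
Proof.
move=> cc cS.
pose a x : prod_topology (fun i => cyc (n i)) := fun i => inZp (c i x).
have ha x : invlim n (a x).
  by move=> i; apply: cyc_proj_inZp; rewrite ?odo_pos ?odo_dvd // cS.
pose h x : odometer n := SigSub (mem_set (ha x)) : odo_space n.
have coordh i x : coord i (h x) = (c i x %% n i)%N.
  exact: cyc_valE (odo_pos n i).
exists h; last by move=> i x; rewrite coordh modn_mod.
split.
  apply: continuous_odometer => i.
  rewrite (_ : _ \o _ = modn^~ (n i) \o c i).
    exact: (locconst_comp _ (cc i).1).
  by apply/funext => x; exact: coordh.
apply/funext => x; apply: odometer_eq => i /=.
rewrite coordh (cc i).2 -[RHS](modn_small (coord_ltn i _)).
by rewrite (coord_clock i).2 coordh -addn1 -modnDml addn1.
Qed.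

End OdometerMaps.

(** * Maps out of a system into odometers *)

Lemma catA_dmor_unique (A Y : dynsys) (n : odo_seq) (u v : dmor A Y) (a : A) :
  isomorphic (A : K0) (odometer n : K0) -> sval u a = sval v a -> u = v.
Proof.
move=> [w [w' [w'w _]]] uva; apply: sval_inj.
have w'wE x : sval w' (sval w x) = x.
  by have := congr1 (fun h : dmor A A => sval h x) w'w.
have uv : sval u \o sval w' = sval v \o sval w'.
  apply: (odometer_dmor_unique (a := sval w a)) => /=; last by rewrite w'wE.
    exact: (is_dmor_comp u w').
  exact: (is_dmor_comp v w').
by apply/funext => x; have := congr1 (@^~ (sval w x)) uv; rewrite /= w'wE.
Qed.

(** Both morphisms take the image in [b1] of a point of [X] to its image in
    [b2], so they agree somewhere. *)
Lemma catB_hom_unique (X : dynsys) (b1 b2 : catB X) (u v : Hom b1 b2) : u = v.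
Proof.
have [x0 _] := @space_nonempty X.
case: b1 b2 u v => [[[A [n isoA]] pA] h1] [A2 h2] [u eu] [v ev].
apply: sval_inj => /=.
apply: (catA_dmor_unique (a := sval h1 x0) isoA).
have eu' : h2 = dmor_comp u h1 := eu; have ev' : h2 = dmor_comp v h1 := ev.
exact: (congr1 (fun h => sval h x0) (etrans (esym eu') ev')).
Qed.

(** The bound on the ultranatural number that [catAX X] demands follows from
    the morphism [h], since periodic partitions pull back along [h]. *)
Definition odo_catAX (X : dynsys) (n : odo_seq) (h : dmor X (odometer n)) :
    catAX X :=
  exist _ (exist _ (odometer n : K0)
             (ex_intro _ n (isomorphic_refl (odometer n : K0))) : catA)
    (Phi_le (periods_dmor (svalP h))).

Definition odo_catB (X : dynsys) (n : odo_seq) (h : dmor X (odometer n)) :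
    catB X :=
  existT _ (odo_catAX h) h.

(** * A left zero forces indecomposability *)

Lemma left_zero_indecomposable (X : dynsys) :
  Phi (periods X) <> ultranatE ->
  (exists Z : catB X, left_zero Z) -> indecomposable X.
Proof.
move=> /Phi_neqE[p pp [a Xa pa]] [Z lzZ] X1 X2 X12 X120 cl1 cl2 inv1 _.
apply: contrapT => /not_orP[/eqP/set0P[x1 X1x1] /eqP/set0P[x2 X2x2]].
have X2E : X2 = ~` X1.
  apply/seteqP; split=> x; last by have [] : (X1 `|` X2) x by rewrite X12.
  by move=> X2x X1x; have : (X1 `&` X2) x by []; rewrite X120.
have /periodsP[_ [c0 cc0]] := Xa; have cc := clock_dvd pa cc0.
(* The second clock is one ahead of the first on [X2]. *)
pose d x := (c0 x + ~~ `[< X1 x >])%N.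
have invX1 x : `[< X1 (dmap X x) >] = `[< X1 x >].
  apply: asbool_equiv_eq; split=> [|X1x]; last by rewrite -inv1; exists x.
  by rewrite -{1}inv1 => -[y X1y /dmap_inj <-].
have cd : clock p d.
  split=> [|x].
    apply: (@locconst_comp X _ _ (fun x => (c0 x, `[< X1 x >]))
      (fun t : nat * bool => t.1 + ~~ t.2)%N).
    apply: locconst_pair; first exact: cc.1.
    by apply: locconst_bool; split=> //; rewrite -closedC -X2E.
  by rewrite /d invX1 -modnDml cc.2 modnDml addSn.
(* The odometer on a constant sequence is Z/pZ. *)
pose n := @OdoSeq (fun=> p) (fun=> prime_gt0 pp) (fun=> dvdnn p).
have [h mh hc] :=
  @odometer_dmor_clocks n X (fun=> c0) (fun=> cc) (fun _ _ => erefl).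
have [k mk kd] :=
  @odometer_dmor_clocks n X (fun=> d) (fun=> cd) (fun _ _ => erefl).
have [[u eu] _] := lzZ (odo_catB (exist _ h mh)).
have [[v ev] _] := lzZ (odo_catB (exist _ k mk)).
case: Z lzZ u eu v ev => [[[A [m isoA]] pA] g] lzZ u eu v ev.
have ueq x : h x = sval (u : dmor A (odometer n)) (sval g x).
  exact: (congr1 (fun h : dmor X (odometer n) => sval h x) eu).
have veq x : k x = sval (v : dmor A (odometer n)) (sval g x).
  exact: (congr1 (fun h : dmor X (odometer n) => sval h x) ev).
have hk1 : h x1 = k x1.
  apply: odometer_eq => i.
  rewrite -(modn_small (coord_ltn i _)) hc -[RHS](modn_small (coord_ltn i _)) kd.
  by rewrite /d asboolT // addn0.
have uv : (u : dmor A (odometer n)) = v.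
  by apply: (catA_dmor_unique (a := sval g x1) isoA); rewrite -ueq -veq.
have := kd 0 x2; rewrite veq -uv -ueq hc /d.
rewrite asboolF; last by move: X2x2; rewrite X2E.
move/eqP; rewrite /= -[X in X == _ %[mod p]]addn0 eqn_modDl mod0n modn_small //.
exact: prime_gt1.
Qed.

(** * The left zero of an indecomposable system *)

(** A divisibility chain in which every period of [X] divides some term; for
    indecomposable [X] its terms are periods themselves. *)
Definition period_lcm (X : dynsys) (i : nat) : nat :=
  \big[lcmn/1%N]_(j < i.+1 | `[< periods X j >]) (j : nat).

Lemma periods1 (X : dynsys) : periods X 1.
Proof.
apply/periodsP; split=> //; exists (fun=> 0); split=> [B|x]; last by rewrite !modn1.
have [B0|B0] := pselect (B 0).
  by rewrite (_ : _ @^-1` B = setT); [exact: openT | apply/seteqP; split].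
by rewrite (_ : _ @^-1` B = set0); [exact: open0 | apply/seteqP; split].
Qed.

Lemma period_lcm_periods (X : dynsys) (i : nat) :
  indecomposable X -> periods X (period_lcm X i).
Proof.
move=> indX; apply: big_ind; [exact: periods1 | exact: periods_lcm |].
by move=> j /asboolP.
Qed.

Lemma dvdn_period_lcm (X : dynsys) (m : nat) :
  periods X m -> (m %| period_lcm X m)%N.
Proof.
by move=> Xm; rewrite /period_lcm big_mkcond big_ord_recr /= asboolT // dvdn_lcmr.
Qed.

(** The left zero is the map to the odometer on [period_lcm X] given by the
    clocks that vanish at a base point. *)
Lemma indecomposable_left_zero (X : dynsys) :
  indecomposable X -> exists Z : catB X, left_zero Z.
Proof.
move=> indX; have [x0 _] := @space_nonempty X.
have pn i := period_lcm_periods i indX.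
have dvdS i : (period_lcm X i %| period_lcm X i.+1)%N.
  rewrite /period_lcm !(big_mkcond (fun j : 'I__ => `[< periods X j >])).
  by rewrite [X in (_ %| X)%N]big_ord_recr dvdn_lcml.
pose n := @OdoSeq (period_lcm X) (fun i => (iffLR (periodsP X _) (pn i)).1) dvdS.
have based i : exists c, clock (n i) c /\ c x0 = 0 %[mod n i].
  by have [c cc c0] := clock_based x0 (pn i); exists c.
have [c cP] := choice based.
have [h mh hc] : exists2 h : X -> odometer n, is_dmor h &
    forall i x, coord i (h x) = c i x %[mod n i].
  apply: odometer_dmor_clocks => [i|i x]; first exact: (cP i).1.
  apply: (clock_unique indX (x0 := x0) (cP i).1).
    exact: clock_dvd (dvdS i) (cP i.+1).1.
  rewrite (cP i).2 -[RHS](modn_dvdm _ (dvdS i)) (cP i.+1).2.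
  by rewrite (modn_dvdm _ (dvdS i)).
exists (odo_catB (exist _ h mh)) => b.
suff [u _] : exists u : Hom (odo_catB (exist _ h mh)) b, True.
  by exists u; split=> // v _; exact: catB_hom_unique.
case: b => [[[A [m isoA]] pA] k].
have [w [w' [w'w _]]] := isoA.
pose k' : X -> odometer m := sval (w : dmor A (odometer m)) \o sval (k : dmor X A).
have mk' : is_dmor k' := is_dmor_comp (w : dmor A (odometer m)) k.
have kclock j : clock (m j) (coord j \o k').
  exact: clock_comp mk' (coord_clock m j).
have Xm j : periods X (m j).
  by apply/periodsP; split; [exact: odo_pos | exists (coord j \o k')].
have mn j : (m j %| n (m j))%N := dvdn_period_lcm (Xm j).
(* The factor map [q] is the projection of the odometer on [n] to that on [m],
   translated so that it sends [h x0] to [k' x0]. Since [m j] divides the term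
   of index [m j] of [n], that coordinate is the one to reduce modulo [m j]. *)
pose e j (a : odometer n) := (coord (m j) a + coord j (k' x0))%N.
have [q mq qe] : exists2 q : odometer n -> odometer m, is_dmor q &
    forall j a, coord j (q a) = e j a %[mod m j].
  apply: odometer_dmor_clocks => [j|j a].
    apply: clock_shift; exact: clock_dvd (mn j) (coord_clock n (m j)).
  have mle : (m j <= m j.+1)%N by rewrite dvdn_leq ?odo_pos ?odo_dvd.
  rewrite /e -modnDml -modnDmr coordS modnDmr.
  rewrite -(modn_dvdm (coord (m j) a) (mn j)) (coord_le _ mle).
  by rewrite modn_dvdm // modnDml.
have qh x : q (h x) = k' x.
  apply: odometer_eq => j.
  rewrite -(modn_small (coord_ltn j _)) -[RHS](modn_small (coord_ltn j _)).
  have := clock_unique indX (x0 := x0) (c := coord j \o (q \o h)) _ (kclock j).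
  apply; first exact: clock_comp mh (clock_comp mq (coord_clock m j)).
  rewrite /= qe /e -modnDml -(modn_dvdm (coord _ _) (mn j)) hc (cP (m j)).2.
  by rewrite (modn_dvdm _ (mn j)) modnDml add0n.
pose t : dmor (odometer n) A := dmor_comp (w' : dmor (odometer m) A) (exist _ q mq).
have tk : k = dmor_comp t (exist _ h mh).
  apply: sval_inj; apply/funext => x /=; rewrite qh /k' /=.
  exact: (esym (congr1 (fun h : dmor A A => sval h (sval k x)) w'w)).
by exists (@catB_hom X (odo_catB (exist _ h mh))
  (existT _ (exist _ (exist _ A (ex_intro _ m isoA)) pA) k) t tk).
Qed.

(** * Left zeros and indecomposability *)

Theorem lemma4p5 (X : dynsys)
    (S0 : catAX X -> Prop) (S1 : catB' S0 -> Prop) :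
  skeleton S0 -> skeleton S1 ->
  Phi (periods X) <> ultranatE ->
  ((exists Z : full S1, left_zero Z) <-> indecomposable X).
Proof.
move=> /skeleton_iso_dense dense0 /skeleton_iso_dense dense1 PhiX.
have red := iff_trans (left_zero_full dense1)
  (left_zero_full (catB'_iso_dense dense0)).
split=> [/red|/indecomposable_left_zero/red //].
exact: left_zero_indecomposable.
Qed.
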